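(* Let $A$ and $B$ be groups with finite generating sets $S$ and $T$ respectively. For any element $u=wg\in A\,\mathrm{wr}\,B$ with canonical form $u=(b_1\circ a_1)\cdots(b_r\circ a_r)\,g$, where $w=(b_1\circ a_1)\cdots(b_r\circ a_r)\in W$, $g\in B$, the word length of $u$ with respect to the generating set $S\cup T$ of $A\,\mathrm{wr}\,B$ is $$|wg|_{S,T}=\|w\|_A+\mathrm{reach}(u).$$
   Context: $A\,\mathrm{wr}\,B=W\rtimes B$ is the restricted wreath product: $W$ is the group of finitely supported functions $B\to A$, with left action of $B$ given by $(g\circ f)(x)=f(xg)$, and multiplication $(w_1g_1)(w_2g_2)=(w_1(g_1\circ w_2))(g_1g_2)$, so that $gwg^{-1}=g\circ w$. The group $A$ is identified with the subgroup of functions in $W$ supported in $\{1\}$; thus $S\cup T$ generates $A\,\mathrm{wr}\,B$. Every $u\in A\,\mathrm{wr}\,B$ has a canonical form $u=(b_1\circ a_1)\cdots(b_r\circ a_r)\,g$ with $r\ge 0$, $g\in B$, $1\neq a_j\in A$, $b_j\in B$, and $b_i\ne b_j$ for $i\neq j$; it is unique up to permuting the (commuting) factors $b_j\circ a_j$. Define $\|w\|_A=\sum_{j=1}^r|a_j|_S$, where $|\cdot|_S$ is word length in $A$. The Cayley graph $\mathrm{Cay}(B)$ (with respect to $T$, taken symmetric, $T=T^{-1}$) has vertex set $B$ and edges joining $x$ to $xt$ for $x\in B,t\in T$. Then $\mathrm{reach}(u)$ is the minimal length of a path in $\mathrm{Cay}(B)$ that starts at $1$, passes through every vertex $b_1,\dots,b_r$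 (in any order), and ends at $g$. *)

(* Defs.v *)
From HB Require Import structures.
From mathcomp Require Import all_boot.
From mathcomp Require Import finmap boolp classical_sets.

Set Implicit Arguments.
Unset Strict Implicit.
Unset Printing Implicit Defensive.

Import Algebra.

Local Open Scope group_scope.
Local Open Scope fset_scope.

(* The default value 0 is only reached when [P] is empty. *)
Definition least (P : nat -> Prop) : nat :=
  xget 0%N [set n | P n /\ forall m, P m -> (n <= m)%N]%classic.

Lemma least_spec (P : nat -> Prop) (n : nat) :
  P n -> P (least P) /\ forall m, P m -> (least P <= m)%N.
Proof.
move=> Pn; suff: exists k, P k /\ forall m, P m -> (k <= m)%N.
  by move/(xgetPex 0%N).
have exP : exists k, `[< P k >] by exists n; apply/asboolP.
case: (ex_minnP exP) => k /asboolP Pk mink; exists k; split=> // m Pm.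
by apply: mink; apply/asboolP.
Qed.

Section Words.
Variable G : groupType.
Implicit Types (S : {fset G}) (x : G) (l : seq G).

Definition is_word S x l : Prop :=
  {subset l <= S `|` [fset y^-1 | y in S]} /\ \prod_(y <- l) y = x.

Definition generates S : Prop := forall x, exists l, is_word S x l.

Definition word_length S x : nat :=
  least (fun n => exists2 l, is_word S x l & size l = n).

Lemma generates_word_length S x :
  generates S -> exists2 l, is_word S x l & size l = word_length S x.
Proof.
move=> /(_ x)[l Sl].
by case: (@least_spec (fun n => exists2 k, is_word S x k & size k = n)
            (size l) (ex_intro2 _ _ l Sl erefl)).
Qed.

Lemma is_word1 S : is_word S 1 [::].
Proof. by split=> //; rewrite big_nil. Qed.

Lemma is_word_letter S x : x \in S -> is_word S x [:: x].
Proof.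
move=> Sx; split; last by rewrite big_seq1.
by move=> y; rewrite inE => /eqP->; rewrite in_fsetU Sx.
Qed.

Lemma is_wordM S x y l k :
  is_word S x l -> is_word S y k -> is_word S (x * y) (l ++ k).
Proof.
case=> Sl <- [Sk <-]; split; last by rewrite big_cat.
by move=> z; rewrite mem_cat => /orP[/Sl|/Sk].
Qed.

Lemma is_wordV S x l : is_word S x l -> exists k, is_word S x^-1 k.
Proof.
case=> Sl <-; elim: l Sl => [|y l IH] Sl.
  by exists [::]; rewrite big_nil invg1; exact: is_word1.
have [k Sk] : exists k, is_word S (\prod_(z <- l) z)^-1 k.
  by apply: IH => z zl; apply: Sl; rewrite inE zl orbT.
exists (k ++ [:: y^-1]); rewrite big_cons invgM; apply: is_wordM => //.
split; last by rewrite big_seq1.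
move=> z; rewrite inE => /eqP->.
have := Sl y; rewrite mem_head => /(_ isT); rewrite !in_fsetU.
case/orP=> [Sy|/imfsetP[t /= St ->]]; last by rewrite invgK St.
by apply/orP; right; apply/imfsetP; exists y.
Qed.

End Words.

Section Wreath.
Variables A B : groupType.

Definition lamps : Type := {fsfun B -> A with 1}.

HB.instance Definition _ := Choice.on lamps.

Definition lamps_eval (f : lamps) : B -> A := fun_of_fsfun f.
Local Coercion lamps_eval : lamps >-> Funclass.

Lemma lampsP (f h : lamps) : f =1 h -> f = h.
Proof. by move=> fh; apply/fsfunP. Qed.

Definition lamps_one : lamps := [fsfun].

Definition lamps_inv (f : lamps) : lamps := [fsfun x in finsupp f => (f x)^-1].

Definition lamps_mul (f h : lamps) : lamps :=
  [fsfun x in finsupp f `|` finsupp h => f x * h x].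

(* [(g o f)(x) = f(x g)], so the support gets translated by [g^-1]. *)
Definition lamps_act (g : B) (f : lamps) : lamps :=
  [fsfun x in [fset y * g^-1 | y in finsupp f] => f (x * g)].

(* [a : A] as a function supported in [{1}]. *)
Definition lamp1 (a : A) : lamps := [fsfun x in [fset 1] => a].

Lemma lamps_oneE x : lamps_one x = 1.
Proof. by rewrite /lamps_eval fsfun0E. Qed.

Lemma lamps_invE f x : lamps_inv f x = (f x)^-1.
Proof.
rewrite /lamps_eval fsfun_fun; case: ifP => // /negbT xf.
by rewrite fsfun_dflt // invg1.
Qed.

Lemma lamps_mulE f h x : lamps_mul f h x = f x * h x.
Proof.
rewrite /lamps_eval fsfun_fun; case: ifP => // /negbT.
by rewrite in_fsetU => /norP[xf xh]; rewrite !fsfun_dflt // mulg1.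
Qed.

Lemma lamps_actE g f x : lamps_act g f x = f (x * g).
Proof.
rewrite /lamps_eval fsfun_fun; case: ifP => // /negbT xf.
rewrite fsfun_dflt //; apply: contra xf => xf.
by apply/imfsetP; exists (x * g) => //=; rewrite mulgK.
Qed.

Lemma lamp1E a x : lamp1 a x = if x == 1 then a else 1.
Proof. by rewrite /lamps_eval fsfun_fun in_fset1. Qed.

Fact lamps_mulA : associative lamps_mul.
Proof. by move=> f h k; apply: lampsP => x; rewrite !lamps_mulE mulgA. Qed.

Fact lamps_mul1 : left_id lamps_one lamps_mul.
Proof.
by move=> f; apply: lampsP => x; rewrite lamps_mulE lamps_oneE mul1g.
Qed.

Fact lamps_mulr1 : right_id lamps_one lamps_mul.
Proof.
by move=> f; apply: lampsP => x; rewrite lamps_mulE lamps_oneE mulg1.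
Qed.

Fact lamps_mulV : left_inverse lamps_one lamps_inv lamps_mul.
Proof.
move=> f; apply: lampsP => x.
by rewrite lamps_mulE lamps_invE lamps_oneE mulVg.
Qed.

Fact lamps_mulVr : right_inverse lamps_one lamps_inv lamps_mul.
Proof.
move=> f; apply: lampsP => x.
by rewrite lamps_mulE lamps_invE lamps_oneE mulgV.
Qed.

HB.instance Definition _ :=
  isGroup.Build lamps lamps_mulA lamps_mul1 lamps_mulr1 lamps_mulV lamps_mulVr.

Lemma lamps_actM g f h : lamps_act g (f * h) = lamps_act g f * lamps_act g h.
Proof.
by apply: lampsP => x; rewrite lamps_actE !lamps_mulE !lamps_actE.
Qed.

Lemma lamps_act1 f : lamps_act 1 f = f.
Proof. by apply: lampsP => x; rewrite lamps_actE mulg1. Qed.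

Lemma lamps_act_comp g h f :
  lamps_act g (lamps_act h f) = lamps_act (g * h) f.
Proof. by apply: lampsP => x; rewrite !lamps_actE mulgA. Qed.

Lemma lamps_act_one g : lamps_act g 1 = 1.
Proof. by apply: lampsP => x; rewrite lamps_actE !lamps_oneE. Qed.

Record wreath : Type := Wreath { wr_lamps : lamps; wr_pos : B }.

Definition wreath_pair (u : wreath) : lamps * B := (wr_lamps u, wr_pos u).
Definition pair_wreath (p : lamps * B) : wreath := Wreath p.1 p.2.

Fact wreath_pairK : cancel wreath_pair pair_wreath.
Proof. by case. Qed.

HB.instance Definition _ := Choice.copy wreath (can_type wreath_pairK).

Definition wr_one : wreath := Wreath 1 1.

Definition wr_mul (u v : wreath) : wreath :=
  Wreath (wr_lamps u * lamps_act (wr_pos u) (wr_lamps v))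
         (wr_pos u * wr_pos v).

Definition wr_inv (u : wreath) : wreath :=
  Wreath (lamps_act (wr_pos u)^-1 (wr_lamps u)^-1) (wr_pos u)^-1.

Fact wr_mulA : associative wr_mul.
Proof.
move=> [w1 g1] [w2 g2] [w3 g3]; rewrite /wr_mul /=.
by rewrite lamps_actM lamps_act_comp !mulgA.
Qed.

Fact wr_mul1 : left_id wr_one wr_mul.
Proof. by move=> [w g]; rewrite /wr_mul /= lamps_act1 !mul1g. Qed.

Fact wr_mulr1 : right_id wr_one wr_mul.
Proof. by move=> [w g]; rewrite /wr_mul /= lamps_act_one !mulg1. Qed.

Fact wr_mulV : left_inverse wr_one wr_inv wr_mul.
Proof.
move=> [w g]; rewrite /wr_mul /= -lamps_actM mulVg lamps_act_one.
by rewrite mulVg.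
Qed.

Fact wr_mulVr : right_inverse wr_one wr_inv wr_mul.
Proof.
move=> [w g]; rewrite /wr_mul /= lamps_act_comp !mulgV lamps_act1.
by rewrite mulgV.
Qed.

HB.instance Definition _ :=
  isGroup.Build wreath wr_mulA wr_mul1 wr_mulr1 wr_mulV wr_mulVr.

Definition wr_inW (w : lamps) : wreath := Wreath w 1.
Definition wr_inB (g : B) : wreath := Wreath 1 g.
Definition wr_inA (a : A) : wreath := wr_inW (lamp1 a).

Lemma wr_conj g w : wr_inB g * wr_inW w * (wr_inB g)^-1 = wr_inW (lamps_act g w).
Proof.
congr Wreath => /=; last by rewrite !mulg1 mulgV.
by rewrite mul1g invg1 !lamps_act_one !mulg1.
Qed.

Definition wr_gens (S : {fset A}) (T : {fset B}) : {fset wreath} :=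
  [fset wr_inA a | a in S] `|` [fset wr_inB t | t in T].

(* The list [(b_1, a_1), ..., (b_r, a_r)] presents [w] as the product of the
   [b_j o a_j]. *)
Definition canonical_form (w : lamps) (s : seq (B * A)) : Prop :=
  [/\ w = \prod_(p <- s) lamps_act p.1 (lamp1 p.2),
      {in s, forall p, p.2 != 1} &
      uniq [seq p.1 | p <- s]].

Lemma lamps_prodE (I : Type) (r : seq I) (F : I -> lamps) x :
  lamps_eval (\prod_(i <- r) F i) x = \prod_(i <- r) F i x.
Proof.
elim: r => [|i r IH]; first by rewrite !big_nil lamps_oneE.
by rewrite !big_cons lamps_mulE IH.
Qed.

Lemma canonical_form_exists w : exists s, canonical_form w s.
Proof.
exists [seq (x^-1, w x) | x <- finsupp w]; split.
- apply: lampsP => x; rewrite big_map lamps_prodE /=.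
  under eq_bigr do rewrite lamps_actE lamp1E divg_eq1.
  have [xw|xw] := boolP (x \in finsupp w); last first.
    rewrite big_seq big1 => [|y yw]; first exact: fsfun_dflt.
    by case: eqP => // xy; rewrite xy yw in xw.
  have {xw} : x \in enum_fset (finsupp w) by [].
  elim: (enum_fset _) (fset_uniq (finsupp w)) => //= y r IH /andP[yr ur].
  rewrite inE big_cons => /orP[/eqP xy|xr].
    rewrite -{}xy in yr *; rewrite eqxx big_seq big1 ?mulg1 // => z zr.
    by case: eqP => // xz; rewrite xz zr in yr.
  by case: eqP => [xy|_]; [rewrite -xy xr in yr | rewrite mul1g; exact: IH].
- by move=> p /mapP[x xw ->] /=; rewrite -mem_finsupp.
- by rewrite -map_comp map_inj_uniq ?fset_uniq // => x y /= /invg_inj.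
Qed.

Lemma wr_gens_generates S T :
  generates S -> generates T -> generates (wr_gens S T).
Proof.
move=> gS gT.
have embed (G H : groupType) (X : {fset G}) (Y : {fset H}) (f : G -> H) x l :
    f 1 = 1 -> {morph f : y z / y * z} -> {in X, forall y, f y \in Y} ->
    is_word X x l -> exists k, is_word Y (f x) k.
  move=> f1 fM XY [Xl <-]; elim: l Xl => [|y l IH] Xl.
    by exists [::]; rewrite big_nil f1; exact: is_word1.
  have [k Yk] : exists k, is_word Y (f (\prod_(z <- l) z)) k.
    by apply: IH => z zl; apply: Xl; rewrite inE zl orbT.
  have [j Yj] : exists j, is_word Y (f y) j.
    have := Xl y; rewrite mem_head in_fsetU => /(_ isT).
    case/orP=> [/XY/is_word_letter Yy|/imfsetP[t /= /XY/is_word_letter Yt ->]].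
      by exists [:: f y].
    have -> : f t^-1 = (f t)^-1.
      by apply: (mulgI (f t)); rewrite -fM !mulgV.
    exact: is_wordV Yt.
  by exists (j ++ k); rewrite big_cons fM; exact: is_wordM.
have wB g : exists l, is_word (wr_gens S T) (wr_inB g) l.
  have [l Tl] := gT g; apply: (embed _ _ _ _ _ _ _ _ _ _ Tl) => //.
  - move=> x y; congr Wreath => /=.
    by rewrite lamps_act_one mulg1.
  - move=> t Tt; rewrite in_fsetU; apply/orP; right.
    by apply/imfsetP; exists t.
have wA a : exists l, is_word (wr_gens S T) (wr_inA a) l.
  have [l Sl] := gS a; apply: (embed _ _ _ _ _ _ _ _ _ _ Sl) => //.
  - congr Wreath; apply: lampsP => x; rewrite lamp1E lamps_oneE.
    by case: ifP.
  - move=> x y; congr Wreath => /=; last by rewrite mulg1.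
    rewrite lamps_act1; apply: lampsP => z; rewrite lamps_mulE !lamp1E.
    by case: ifP => //; rewrite mulg1.
  - move=> a' Sa; rewrite in_fsetU; apply/orP; left.
    by apply/imfsetP; exists a'.
case=> w g.
have -> : Wreath w g = wr_inW w * wr_inB g.
  by congr Wreath => /=; rewrite ?lamps_act_one ?mulg1 ?mul1g.
have [s [-> _ _]] := canonical_form_exists w.
have [k Wk] : exists k, is_word (wr_gens S T)
    (wr_inW (\prod_(p <- s) lamps_act p.1 (lamp1 p.2))) k; last first.
  by have [l Wl] := wB g; exists (k ++ l); exact: is_wordM.
elim: s => [|[b a] s [k Wk]] /=.
  by exists [::]; rewrite big_nil; exact: is_word1.
have [lb Wb] := wB b; have [la Wa] := wA a; have [lc Wc] := is_wordV Wb.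
exists (((lb ++ la) ++ lc) ++ k); rewrite big_cons.
set v := \prod_(_ <- _) _ in Wk *.
have -> : wr_inW (lamps_act b (lamp1 a) * v)
        = wr_inW (lamps_act b (lamp1 a)) * wr_inW v.
  by congr Wreath => /=; rewrite ?lamps_act1 ?mulg1.
by rewrite -wr_conj; do 3?apply: is_wordM.
Qed.

Definition lamps_norm (S : {fset A}) (s : seq (B * A)) : nat :=
  (\sum_(p <- s) word_length S p.2)%N.

Definition cayley (T : {fset B}) : rel B :=
  fun x y => y \in [fset x * t | t in T].

(* A path is given by the list of its vertices after the initial vertex 1. *)
Definition tour (T : {fset B}) (s : seq (B * A)) (g : B) (p : seq B) : Prop :=
  [/\ path (cayley T) 1 p, {subset [seq q.1 | q <- s] <= 1 :: p} &
      last 1 p = g].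

Definition reach (T : {fset B}) (s : seq (B * A)) (g : B) : nat :=
  least (fun n => exists2 p, tour T s g p & size p = n).

Lemma tour_exists (T : {fset B}) (s : seq (B * A)) (g : B) :
  generates T -> {in T, forall t, t^-1 \in T} -> exists p, tour T s g p.
Proof.
move=> gT symT.
have walk x y : exists2 p, path (cayley T) x p & last x p = y.
  have [l [Tl]] := gT (x^-1 * y).
  move/(congr1 (fun z => x * z)); rewrite mulVKg => <-{y}.
  elim: l x Tl => [|t l IH] x Tl; first by exists [::]; rewrite // big_nil mulg1.
  have [p xp lp] := IH (x * t) (fun z zl => Tl z (@mem_behead _ (t :: l) z zl)).
  exists (x * t :: p) => /=; last by rewrite lp big_cons mulgA.
  rewrite xp andbT; apply/imfsetP; exists t => //=.
  have := Tl t (mem_head _ _); rewrite in_fsetU.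
  by case/orP=> // /imfsetP[z /= Tz ->]; exact: symT.
rewrite /tour; elim: s 1 => [|[b a] s IH] x /=.
  by have [p xp <-] := walk x g; exists p; split.
have [p xp lp] := walk x b; have [q [bq sq lq]] := IH b.
exists (p ++ q); rewrite cat_path last_cat lp xp bq; split=> // y.
rewrite -cat_cons mem_cat inE => /orP[/eqP->|/sq].
  by rewrite -lp mem_last.
by rewrite inE => /orP[/eqP->|->]; rewrite ?orbT // -lp mem_last.
Qed.

End Wreath.

Arguments wr_inW {A B}.
Arguments wr_inB {A B}.
Arguments wr_inA {A B}.

(* Main.v *)
Require Import Defs.
From mathcomp Require Import all_boot finmap.

(** Reading a word from left to right, a letter of [T] moves a lamplighter along
an edge of the Cayley graph and a letter of [S] changes the lamp at the current
position: right multiplication by [a] sends [(w, x)] to [(w (x o a), x)].  So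
the [T]-letters trace a tour through all lit lamps and the [S]-letters spell
each lamp's value, which bounds the length from below; conversely, writing a
geodesic word for each lamp at the first visit of an optimal tour attains the
bound. *)

Set Implicit Arguments.
Unset Strict Implicit.
Unset Printing Implicit Defensive.

Import Algebra.

Local Open Scope group_scope.
Local Open Scope fset_scope.

(** * Preliminaries on word length, lamps and finite sums *)

Section WordLength.
Variable G : groupType.
Implicit Types (S : {fset G}) (x y : G) (l : seq G).

Lemma word_length_min S x l : is_word S x l -> (word_length S x <= size l)%N.
Proof.
move=> Sl; have [_] := @least_spec
  (fun n => exists2 k, is_word S x k & size k = n) _ (ex_intro2 _ _ l Sl erefl).
by apply; exists l.
Qed.

Lemma word_length1 S : word_length S 1 = 0%N.
Proof. by apply/eqP; rewrite -leqn0; exact: word_length_min (is_word1 S). Qed.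

Lemma word_length_letter S x :
  x \in S `|` [fset y^-1 | y in S] -> (word_length S x <= 1)%N.
Proof.
move=> Sx; apply: (@word_length_min S x [:: x]); split; last by rewrite big_seq1.
by move=> y; rewrite inE => /eqP->.
Qed.

Lemma word_lengthM S x y : generates S ->
  (word_length S (x * y) <= word_length S x + word_length S y)%N.
Proof.
move=> genS; have [l Sl <-] := generates_word_length x genS.
have [k Sk <-] := generates_word_length y genS.
by rewrite -size_cat; exact/word_length_min/is_wordM.
Qed.

End WordLength.

(** Since [(x o a)(z) = a(z * x)], the function [x o a] is supported at [x^-1]: the lamp at position
    [b] is stored at index [b^-1], which explains the recurring argument [b^-1 * x]. *)
Lemma lamp1_translate (A B : groupType) (a : A) (b x : B) :
  lamps_eval (lamp1 B a) (b^-1 * x) = if b == x then a else 1.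
Proof. by rewrite lamp1E mulg_eq1 (inj_eq invg_inj). Qed.

(** Lets the first vertex of a path be split off whether or not its lamp is lit. *)
Lemma sum_uniqD1 (I : eqType) (r : seq I) (x : I) (F : I -> nat) :
  uniq r -> (x \notin r -> F x = 0%N) ->
  (\sum_(i <- r) F i = F x + \sum_(i <- [seq i <- r | i != x]) F i)%N.
Proof.
move=> ur Fx; have [xr|xr] := boolP (x \in r).
  by rewrite big_filter (bigD1_seq x).
have /all_filterP-> : all (fun i => i != x) r.
  by apply/allP => i; apply: contraTneq => ->.
by rewrite Fx.
Qed.

(** * Letters of the wreath product *)

Section WreathLength.
Variables (A B : groupType) (S : {fset A}) (T : {fset B}).
Local Coercion lamps_eval : lamps >-> Funclass.
Implicit Types (a : A) (x t g b : B) (w v : lamps A B) (bs p : seq B).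

Lemma lamp1M a c : lamp1 B (a * c) = lamp1 B a * lamp1 B c.
Proof.
apply: lampsP => z; rewrite lamps_mulE !lamp1E.
by case: ifP => //; rewrite mulg1.
Qed.

Lemma lamp1_1 : lamp1 B (1 : A) = 1.
Proof. by apply: lampsP => z; rewrite lamp1E lamps_oneE if_same. Qed.

Lemma wr_inA_mul a w g :
  wr_inA a * Wreath w g = Wreath (lamp1 B a * w) g.
Proof. by congr Wreath => /=; rewrite ?lamps_act1 ?mul1g. Qed.

Lemma wr_inB_mul t w g :
  wr_inB t * Wreath w g = Wreath (lamps_act t w) (t * g).
Proof. by congr Wreath => /=; rewrite mul1g. Qed.

Lemma wr_inAV a : (wr_inA a)^-1 = wr_inA a^-1 :> wreath A B.
Proof.
apply: (mulgI (wr_inA a)); rewrite mulgV wr_inA_mul -lamp1M mulgV.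
by rewrite lamp1_1.
Qed.

Lemma wr_inBV t : (wr_inB t)^-1 = wr_inB t^-1 :> wreath A B.
Proof.
by apply: (mulgI (wr_inB t)); rewrite mulgV wr_inB_mul lamps_act_one mulgV.
Qed.

Notation letters X := (X `|` [fset y^-1 | y in X]).

Lemma wr_letterA a : a \in letters S -> wr_inA a \in letters (wr_gens S T).
Proof.
rewrite !in_fsetU => /orP[Sa|/imfsetP[c /= Sc ->]].
  by rewrite (in_imfset _ (@wr_inA A B)).
apply/orP; right; rewrite -wr_inAV.
by apply/imfsetP; exists (wr_inA c); rewrite //= in_fsetU in_imfset.
Qed.

Lemma wr_letterB t : t \in T -> wr_inB t \in letters (wr_gens S T).
Proof. by move=> Tt; rewrite !in_fsetU (in_imfset _ (@wr_inB A B)) ?orbT. Qed.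

Lemma is_word_inA a l : is_word S a l ->
  is_word (wr_gens S T) (wr_inA a) [seq wr_inA c | c <- l].
Proof.
case=> Sl <-; split; first by move=> y /mapP[c /Sl/wr_letterA + ->].
rewrite big_map; elim: l {Sl} => [|c l IH].
  by rewrite !big_nil /wr_inA lamp1_1.
by rewrite !big_cons IH wr_inA_mul -lamp1M.
Qed.

Hypothesis symT : forall t, t \in T -> t^-1 \in T.

(** Symmetry of [T] absorbs the inverses of its letters, so each letter from [B] is a Cayley edge;
    inverses from [S] stay in [letters S]. *)
Variant wr_letter_spec : wreath A B -> Prop :=
  | WrLetterA a of a \in letters S : wr_letter_spec (wr_inA a)
  | WrLetterB t of t \in T : wr_letter_spec (wr_inB t).

Lemma wr_letterP y : y \in letters (wr_gens S T) -> wr_letter_spec y.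
Proof.
rewrite in_fsetU => /orP[|/imfsetP[z /= + ->]]; rewrite in_fsetU;
  case/orP=> /imfsetP[c /= cX ->]; rewrite ?wr_inAV ?wr_inBV; constructor.
- by rewrite in_fsetU cX.
- by [].
- by rewrite in_fsetU in_imfset ?orbT.
- exact: symT.
Qed.

(** * From words to paths and back *)

Hypothesis genS : generates S.

Lemma mem_cayley x t : t \in T -> cayley T x (x * t).
Proof. by move=> Tt; apply/imfsetP; exists t. Qed.

(* [w (b^-1 * x)] is the value at [b^-1] of [x o w], that is, the lamp at [b]
   after running from position [x] a word for [w]. *)
Lemma word_to_path x u l : is_word (wr_gens S T) u l ->
  exists p, [/\ path (cayley T) x p, last x p = x * wr_pos u,
    forall b, wr_lamps u (b^-1 * x) != 1 -> b \in x :: p &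
    forall bs, uniq bs ->
      (\sum_(b <- bs) word_length S (wr_lamps u (b^-1 * x)%g) + size p
        <= size l)%N].
Proof.
case=> + <- {u}; elim: l x => [|y l IH] x Xl.
  exists [::]; rewrite big_nil; split=> //=; first by rewrite mulg1.
    by move=> b; rewrite lamps_oneE eqxx.
  by move=> bs _; rewrite big1 // => b _; rewrite lamps_oneE word_length1.
have {}IH x' := IH x' (fun z zl => Xl z (@mem_behead _ (y :: l) z zl)).
rewrite big_cons; case: (\prod_(z <- l) z) IH => w g IH.
case/wr_letterP: (Xl _ (mem_head _ _)) => [a Sa|t Tt].
  have [p [xp lp wp np]] := IH x; exists p.
  rewrite wr_inA_mul /=; split=> // [b|bs ubs].
    rewrite lamps_mulE lamp1_translate; case: (b =P x) => [->|_].
      by rewrite mem_head.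
    by rewrite mul1g => /wp.
  (* The letter [a] changes only the lamp at [x], which occurs at most once in [bs], and by
     subadditivity raises its length by at most 1. *)
  apply: leq_trans (_ : 1 + _ <= _)%N; last exact: np ubs.
  rewrite addnA leq_add2r.
  apply: leq_trans (_ : \sum_(b <- bs)
      ((b == x) + word_length S (w (b^-1 * x)%g)) <= _)%N.
    apply: leq_sum => b _; rewrite lamps_mulE lamp1_translate.
    apply: leq_trans (word_lengthM _ _ genS) _; rewrite leq_add2r.
    by case: ifP => _; rewrite ?word_length1 ?word_length_letter.
  rewrite big_split leq_add2r /=.
  by rewrite -big_mkcond sum1_count count_uniq_mem ?leq_b1.
(* A letter of [T] costs one edge and keeps all lamps: [(t o w)(b^-1 * x) = w(b^-1 * (x * t))]. *)
have [p [xp lp wp np]] := IH (x * t); exists (x * t :: p).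
rewrite wr_inB_mul /= lp xp mem_cayley // mulgA; split=> // [b|bs ubs].
  by rewrite lamps_actE -mulgA => /wp bp; rewrite inE bp orbT.
rewrite addnS ltnS; apply: leq_trans (np _ ubs).
by under eq_bigr do rewrite lamps_actE -mulgA.
Qed.

(** Induction on the path, which is why its start [x] is arbitrary. The list [bs] may contain unlit
    lamps, as these contribute length 0. *)
Lemma path_to_word x p w bs : path (cayley T) x p -> uniq bs ->
    {subset bs <= x :: p} -> (forall b, w (b^-1 * x) != 1 -> b \in bs) ->
  exists2 l, is_word (wr_gens S T) (Wreath w (x^-1 * last x p)) l &
    size l = (\sum_(b <- bs) word_length S (w (b^-1 * x)%g) + size p)%N.
Proof.
elim: p x w bs => [|y p IH] x w bs + ubs bsp wbs.
  all: have [la Sa szla] := generates_word_length (w 1) genS.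
  all: have/is_word_inA Wa := Sa.
  (* Spell the lamp at the first vertex [x], then walk on with that lamp off. *)
  all: pose v : lamps A B := lamp1 B (w 1)^-1 * w.
  all: have wE : w = lamp1 B (w 1) * v
    by rewrite mulgA -lamp1M mulgV lamp1_1 mul1g.
  all: have vE b : v (b^-1 * x) = if b == x then 1 else w (b^-1 * x)
    by rewrite /v lamps_mulE lamp1_translate; case: eqP => [->|_];
      rewrite ?mul1g // !mulVg.
  all: have w1 : x \notin bs -> word_length S (w (x^-1 * x)) = 0%N
    by move=> /(contra (@wbs x)); rewrite negbK => /eqP->;
      exact: word_length1.
  all: rewrite (sum_uniqD1 ubs w1) mulVg -szla.
- move=> _; exists [seq wr_inA c | c <- la].
    suff -> : w = lamp1 B (w 1) by [].
    rewrite [LHS]wE (_ : v = 1) ?mulg1 //; apply: lampsP => z.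
    (* The witness solves [b^-1 * x = z]; with an empty walk only the lamp at [x] can be lit. *)
    have := vE (x * z^-1); rewrite invgM invgK mulgVK lamps_oneE => ->.
    case: eqP => // xz; apply/eqP/contraT => wz.
    have := wbs (x * z^-1); rewrite invgM invgK mulgVK => /(_ wz)/bsp.
    by rewrite inE => /eqP.
  rewrite size_map big_seq big1 ?addn0 // => b; rewrite mem_filter.
  by case/andP=> bx /bsp; rewrite inE (negPf bx).
rewrite /= => /andP[/imfsetP[t /= Tt yE] xp]; subst y.
(* Acting by [t^-1] cancels the shift that the letter [wr_inB t] causes. *)
have [||b|l Wl szl] := IH _ (lamps_act t^-1 v) [seq b <- bs | b != x] xp.
- exact: filter_uniq.
- move=> b; rewrite mem_filter => /andP[bx /bsp].
  by rewrite inE (negPf bx).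
- rewrite lamps_actE mulgA mulgK vE mem_filter.
  by case: (b =P x) => [_|_ /wbs]; rewrite ?eqxx.
exists ([seq wr_inA c | c <- la] ++ wr_inB t :: l).
  suff -> : Wreath w (x^-1 * last x (x * t :: p)) = wr_inA (w 1) *
      (wr_inB t * Wreath (lamps_act t^-1 v) ((x * t)^-1 * last (x * t) p)).
    apply: is_wordM => //; rewrite -cat1s; apply: is_wordM => //.
    split; last by rewrite big_seq1.
    by move=> z; rewrite inE => /eqP->; exact: wr_letterB.
  rewrite wr_inB_mul wr_inA_mul lamps_act_comp mulgV lamps_act1 -wE.
  by rewrite invgM !mulgA mulgV mul1g.
rewrite size_cat size_map /= szl !addnS addnA; congr (_ + _ + _).+1.
rewrite !big_filter; apply: eq_bigr => b bx.
by rewrite lamps_actE mulgA mulgK vE (negPf bx).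
Qed.

End WreathLength.

(** * Lamps read off a canonical form, and the length formula *)

Lemma canonical_form_lamp (A B : groupType) (w : lamps A B)
    (s : seq (B * A)) (q : B * A) :
  canonical_form w s -> q \in s -> lamps_eval w q.1^-1 = q.2.
Proof.
case=> -> _ + qs; case/splitPr: qs => s1 s2.
rewrite map_cat cat_uniq /= negb_or => /and3P[_ /andP[q1 _] /andP[q2 _]].
have off r (t : seq (B * A)) : q.1 \notin [seq p.1 | p <- t] -> r \in t ->
    lamps_eval (lamps_act r.1 (lamp1 B r.2)) q.1^-1 = 1.
  move=> qt rt; rewrite lamps_actE lamp1_translate; case: eqP => // qr.
  by rewrite qr map_f in qt.
rewrite lamps_prodE big_cat big_cons /= lamps_actE lamp1E mulVg eqxx.
by rewrite !big_seq !big1 ?mul1g ?mulg1 // => r; apply: off.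
Qed.

Lemma canonical_form_support (A B : groupType) (w : lamps A B)
    (s : seq (B * A)) (b : B) :
  canonical_form w s -> (lamps_eval w b^-1 != 1) = (b \in [seq q.1 | q <- s]).
Proof.
move=> ws; apply/idP/idP => [|/mapP[q qs ->]]; last first.
  by rewrite (canonical_form_lamp ws) //; case: ws => _ /(_ q qs).
case: ws => -> _ _; apply: contraNT => bs.
rewrite lamps_prodE big_seq big1 // => q qs.
rewrite lamps_actE lamp1_translate; case: eqP => // bq.
by rewrite bq map_f in bs.
Qed.

Theorem theorem3p4 (A B : groupType) (S : {fset A}) (T : {fset B})
    (genS : generates S) (genT : generates T)
    (symT : forall t : B, t \in T -> (t^-1)%g \in T)
    (w : lamps A B) (g : B) (s : seq (B * A)) (ws : canonical_form w s) :
  word_length (wr_gens S T) (wr_inW w * wr_inB g)%g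
  = (lamps_norm S s + reach T s g)%N.
Proof.
have -> : wr_inW w * wr_inB g = Wreath w g.
  by congr Wreath => /=; rewrite ?lamps_act1 ?mulg1 ?mul1g.
have us : uniq [seq q.1 | q <- s] by case: ws.
have normE : lamps_norm S s = (\sum_(b <- [seq q.1 | q <- s])
    word_length S (lamps_eval w (b^-1 * 1)%g))%N.
  rewrite big_map /lamps_norm big_seq [RHS]big_seq; apply: eq_bigr => q qs.
  by rewrite mulg1 (canonical_form_lamp ws).
(* Some tour exists, so [reach] is an attained minimum and not the default 0. *)
have [p0 tour0] := tour_exists s g genT symT.
have [[p [xp sp lp] szp] minp] := @least_spec
  (fun n => exists2 p, tour T s g p & size p = n) _ (ex_intro2 _ _ p0 tour0 erefl).
rewrite -/(reach T s g) in szp minp.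
apply/eqP; rewrite eqn_leq; apply/andP; split.
  have [|l Wl szl] := @path_to_word _ _ S T genS 1 p w _ xp us sp.
    by move=> b; rewrite mulg1 (canonical_form_support _ ws).
  rewrite normE -szp -szl; apply: word_length_min.
  by rewrite lp invg1 mul1g in Wl.
(* The path traced by a geodesic word is itself a tour, hence at least as long as [reach]. *)
have [l Wl <-] := generates_word_length (Wreath w g) (wr_gens_generates genS genT).
have [q [xq lq wq nq]] := word_to_path symT genS 1 Wl.
apply: leq_trans (nq _ us); rewrite normE leq_add2l; apply: minp.
exists q => //; split=> // [b|]; last by rewrite lq mul1g.
by rewrite -(canonical_form_support _ ws) -[b^-1]mulg1 => /wq.
Qed.
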